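(* Let $R_{i,j}$, $U(\beta)$, $D(\beta)$ be the matrices and $\rho_g^z,\rho_r^z,\rho_b^z$ the representations of the connective quantum affine algebra $U_q(\beta,\widehat a_2)$ (a specialization of the multi-parameter quantum group of type $\widehat{\mathfrak a}_2$) given in the context; the nonzero entries of $R_{g,r}$ are the fugacities of the rhombus puzzle pieces. Put $$\overline R_{b,r}(z)=R_{b,r}(1/z),\quad \overline R_{b,g}(z)=R_{b,g}(q^4/z),\quad \overline R_{r,g}(z)=R_{r,g}(q^4/z),$$ $$\overline R_{r,b}(z)=R_{r,b}(1/z),\quad \overline R_{g,b}(z)=R_{g,b}(1/(q^4z)),\quad \overline R_{g,r}(z)=R_{g,r}(1/(q^4z)).$$ Then for every $\ell\in\{0,1,2\}$, every $X\in\{E_\ell,F_\ell,K_\ell^{(1)},K_\ell^{(2)}\}$ and every $(i,j)\in\{(g,r),(r,g),(b,r),(r,b),(g,b),(b,g)\}$: $$\overline R_{i,j}(z_2/z_1)\circ(\rho_i^{z_1}\otimes\rho_j^{z_2})(\Delta(X))=(\rho_j^{z_2}\otimes\rho_i^{z_1})(\Delta(X))\circ\overline R_{i,j}(z_2/z_1),$$ $$U(\beta)\circ(\rho_g^{qz}\otimes\rho_r^{q^{-1}z})(\Delta(X))=\rho_b^{q^{-2}z}(X)\circ U(\beta),$$ $$D(\beta)\circ\rho_b^{q^{-2}z}(X)=(\rho_r^{q^{-1}z}\otimes\rho_g^{qz})(\Delta(X))\circ D(\beta).$$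
   Context: $q,\beta,z,z_1,z_2$ are indeterminates; all matrices have entries in the field of rational functions in them. $Q=Q(\beta,q)=q^2+\beta-q^2\beta$ and $a=\beta(1-q^2)$. $V$ is the $3$-dimensional space with ordered basis $v_1,v_0,v_{10}$; write $(k,l)$ for $v_k\otimes v_l$. The dependence of $R$-matrices on $\beta$ is suppressed: $R_{i,j}(\cdot)=R_{i,j}(\beta,\cdot)$. **Quantum group.** $U_q(\beta,\widehat a_2)$ is the algebra over $\mathbb Q(q,\beta)$ (extended to contain the other indeterminates) generated by $E_i,F_i,(K_i^{(1)})^{\pm1},(K_i^{(2)})^{\pm1}$, $i=0,1,2$, where all $K$'s commute and $K_i^{(1)}E_j(K_i^{(1)})^{-1}=q_{i,j}E_j$, $(K_i^{(2)})^{-1}E_jK_i^{(2)}=q_{j,i}^{-1}E_j$, $K_i^{(1)}F_j(K_i^{(1)})^{-1}=q_{i,j}^{-1}F_j$, $(K_i^{(2)})^{-1}F_jK_i^{(2)}=q_{j,i}F_j$, $[E_i,F_j]=\delta_{i,j}\frac{q_{i,i}}{q_{i,i}-1}(K_i^{(1)}-(K_i^{(2)})^{-1})$, and for $i\ne j$: $E_i^2E_j-q_{i,j}(1+q_{i,i})E_iE_jE_i+\frac{q_{i,j}}{q_{j,i}}E_jE_i^2=0$, $\frac{q_{i,j}}{q_{j,i}}F_i^2F_j-q_{i,j}(1+q_{i,i})F_iF_jF_i+F_jF_i^2=0$; with parameters $q_{0,0}=q_{1,1}=q_{2,2}=\frac{q^2}{Q}$, $q_{1,0}=q_{2,1}=q_{0,2}=\frac1q$,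 $q_{2,0}=q_{0,1}=q_{1,2}=\frac Qq$. Coproduct: $\Delta(E_i)=K_i^{(1)}\otimes E_i+E_i\otimes1$, $\Delta(F_i)=1\otimes F_i+F_i\otimes(K_i^{(2)})^{-1}$, $\Delta(K_i^{(m)})=K_i^{(m)}\otimes K_i^{(m)}$. **Representations** on $V$ ($e_{st}$ = matrix unit in the ordered basis): - $\rho_g^z$: $E_0=-\frac{q^2}{z}e_{31}$, $E_1=q\,e_{12}$, $E_2=-e_{23}$; $F_0=-\frac zq e_{13}$, $F_1=\frac1Qe_{21}$, $F_2=-q\,e_{32}$; $K^{(1)}_0=\mathrm{diag}(\frac Qq,1,q)$, $K^{(1)}_1=\mathrm{diag}(\frac qQ,\frac1q,\frac1Q)$, $K_2^{(1)}=\mathrm{diag}(1,q,\frac Qq)$; $K^{(2)}_0=\mathrm{diag}(\frac1q,1,\frac qQ)$, $K_1^{(2)}=\mathrm{diag}(q,\frac Qq,Q)$, $K_2^{(2)}=\mathrm{diag}(1,\frac qQ,\frac1q)$. - $\rho_r^z$: $E_0=-\frac1ze_{23}$, $E_1=-q^2e_{31}$, $E_2=\frac qQe_{12}$; $F_0=-qz\,e_{32}$, $F_1=-\frac1qe_{13}$, $F_2=e_{21}$; $K^{(1)}_0=\mathrm{diag}(1,q,\frac Qq)$, $K_1^{(1)}=\mathrm{diag}(\frac Qq,1,q)$, $K_2^{(1)}=\mathrm{diag}(\frac qQ,\frac1q,\frac1Q)$; $K^{(2)}_0=\mathrm{diag}(1,\frac qQ,\frac1q)$, $K_1^{(2)}=\mathrm{diag}(\frac1q,1,\frac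 qQ)$, $K_2^{(2)}=\mathrm{diag}(q,\frac Qq,Q)$. - $\rho_b^z$: $E_0=-\frac1{qz}e_{21}$, $E_1=q\,e_{32}$, $E_2=\frac qQe_{13}$; $F_0=-q^2z\,e_{12}$, $F_1=\frac1Qe_{23}$, $F_2=e_{31}$; $K^{(1)}_0=\mathrm{diag}(\frac Qq,q,Q)$, $K_1^{(1)}=\mathrm{diag}(1,\frac1q,\frac qQ)$, $K_2^{(1)}=\mathrm{diag}(\frac qQ,1,\frac1q)$; $K^{(2)}_0=\mathrm{diag}(\frac1q,\frac qQ,\frac1Q)$, $K_1^{(2)}=\mathrm{diag}(1,\frac Qq,q)$, $K_2^{(2)}=\mathrm{diag}(q,1,\frac Qq)$. **$R$-matrices** (linear maps $V\otimes V\to V\otimes V$). With $E=Q-q^2z$, $R_{g,r}(z/q^2)$ is $(1,1)\mapsto(1,1)+\frac aE(10,0)$; $(1,0)\mapsto(0,1)-\frac{qa}E(10,10)$; $(1,10)\mapsto\frac{qQ(1-z)}E(10,1)$; $(0,1)\mapsto\frac{q(1-z)}E(1,0)$; $(0,0)\mapsto(0,0)+\frac aE(1,10)$; $(0,10)\mapsto\frac{az}E(1,1)+(10,0)$; $(10,1)\mapsto(1,10)+\frac{az}E(0,0)$; $(10,0)\mapsto\frac{qQ(1-z)}E(0,10)$; $(10,10)\mapsto-\frac{aQz}{qE}(0,1)+Q(10,10)$. With $u=1/z$ and $D_u=Q-q^2u$, both $R_{b,r}(z/q)$ and $R_{g,b}(z/q)$ satisfy $(1,1)\mapsto(1,1)$;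 $(0,1)\mapsto(1,0)$; $(0,0)\mapsto(0,0)$; $(1,10)\mapsto(10,1)$; $(10,0)\mapsto(0,10)$; $(10,10)\mapsto Q(10,10)$; $(1,0)\mapsto\frac1{D_u}[au(1,10)+q(1-u)(0,1)+au(10,0)]$; and - for $R_{b,r}(z/q)$: $(0,10)\mapsto\frac1{D_u}[-\frac{aQ}q(1,10)+a(0,1)+qQ(1-u)(10,0)]$, $(10,1)\mapsto\frac1{D_u}[qQ(1-u)(1,10)+a(0,1)-qau(10,0)]$; - for $R_{g,b}(z/q)$: $(0,10)\mapsto\frac1{D_u}[-qau(1,10)+a(0,1)+qQ(1-u)(10,0)]$, $(10,1)\mapsto\frac1{D_u}[qQ(1-u)(1,10)+a(0,1)-\frac{aQ}q(10,0)]$. Further $R_{r,g}(q^2z)=R_{g,r}(1/(q^2z))^{-1}$, $R_{r,b}(qz)=R_{b,r}(1/(qz))^{-1}$, $R_{b,g}(qz)=R_{g,b}(1/(qz))^{-1}$. **$U$ and $D$.** $D(\beta):V\to V\otimes V$: $v_1\mapsto(1,1)+(10,0)$, $v_0\mapsto(1,10)+(0,0)$, $v_{10}\mapsto(0,1)-q(10,10)$. $U(\beta):V\otimes V\to V$: $(1,1),(0,10)\mapsto v_1$; $(0,0),(10,1)\mapsto v_0$; $(1,0)\mapsto v_{10}$; $(10,10)\mapsto-\frac Qq v_{10}$; all other basis vectors $\mapsto0$. *)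

(* Defs.v *)
From HB Require Import structures.
From mathcomp Require Import all_boot all_order all_algebra.
From mathcomp Require Import mpoly mxtens ring.

Set Implicit Arguments.
Unset Strict Implicit.
Unset Printing Implicit Defensive.

Import GRing.Theory.
Local Open Scope ring_scope.

Definition tri (T : Type) (x0 x1 x2 : T) (i : 'I_3) : T :=
  match val i with 0%N => x0 | 1%N => x1 | _ => x2 end.

(* The generators of U_q(beta, a2^); gK1V i and gK2V i stand for the inverses
   of K_i^(1) and K_i^(2). *)
Inductive gen : Type :=
  | gE of 'I_3 | gF of 'I_3
  | gK1 of 'I_3 | gK1V of 'I_3 | gK2 of 'I_3 | gK2V of 'I_3.

(* A word stands for the product of its letters, [::] for the unit. *)
Definition word := seq gen.

(* The coproduct of a generator, as a formal sum of pure tensors of words. *)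
Definition Delta (x : gen) : seq (word * word) :=
  match x with
  | gE i => [:: ([:: gK1 i], [:: gE i]); ([:: gE i], [::])]
  | gF i => [:: ([::], [:: gF i]); ([:: gF i], [:: gK2V i])]
  | _ => [:: ([:: x], [:: x])]
  end.

Inductive color : Type := green | red | blue.

(* The ordered basis v_1, v_0, v_10 of V. *)
Inductive basisV : Type := v1 | v0 | v10.

Definition basisV_seq : seq basisV := [:: v1; v0; v10].

Definition o1 : 'I_3 := @Ordinal 3 0 isT.
Definition o2 : 'I_3 := @Ordinal 3 1 isT.
Definition o3 : 'I_3 := @Ordinal 3 2 isT.

Definition basisV_ord (k : basisV) : 'I_3 :=
  match k with v1 => o1 | v0 => o2 | v10 => o3 end.

Section QuantumGroup.
Variables (F : fieldType) (q beta : F).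

Definition Qpar : F := q ^+ 2 + beta - q ^+ 2 * beta.
Local Notation Q := Qpar.

Definition apar : F := beta * (1 - q ^+ 2).
Local Notation a := apar.

Definition qpar : 'I_3 -> 'I_3 -> F :=
  tri (tri (q ^+ 2 / Q) (Q / q)      q^-1)
      (tri q^-1         (q ^+ 2 / Q) (Q / q))
      (tri (Q / q)      q^-1         (q ^+ 2 / Q)).

Section Relations.
Variables (A : algType F) (f : gen -> A).
Local Notation E i := (f (gE i)).
Local Notation F_ i := (f (gF i)).
Local Notation K1 i := (f (gK1 i)).
Local Notation K1V i := (f (gK1V i)).
Local Notation K2 i := (f (gK2 i)).
Local Notation K2V i := (f (gK2V i)).

(* The defining relations of U_q(beta, a2^): an assignment f of elements of A
   to the generators extends (uniquely) to an algebra morphism on U_q if and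
   only if it satisfies them. *)
Record Uq_relations : Prop := UqRelations {
  Uq_K1K1V : forall i, K1 i * K1V i = 1;
  Uq_K1VK1 : forall i, K1V i * K1 i = 1;
  Uq_K2K2V : forall i, K2 i * K2V i = 1;
  Uq_K2VK2 : forall i, K2V i * K2 i = 1;
  Uq_K1K1 : forall i j, K1 i * K1 j = K1 j * K1 i;
  Uq_K1K2 : forall i j, K1 i * K2 j = K2 j * K1 i;
  Uq_K2K2 : forall i j, K2 i * K2 j = K2 j * K2 i;
  Uq_K1E : forall i j, K1 i * E j * K1V i = qpar i j *: E j;
  Uq_K2E : forall i j, K2V i * E j * K2 i = (qpar j i)^-1 *: E j;
  Uq_K1F : forall i j, K1 i * F_ j * K1V i = (qpar i j)^-1 *: F_ j;
  Uq_K2F : forall i j, K2V i * F_ j * K2 i = qpar j i *: F_ j;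
  Uq_EF : forall i j, E i * F_ j - F_ j * E i =
    if i == j then (qpar i i / (qpar i i - 1)) *: (K1 i - K2V i) else 0;
  Uq_SerreE : forall i j, i != j ->
    E i ^+ 2 * E j - (qpar i j * (1 + qpar i i)) *: (E i * E j * E i)
      + (qpar i j / qpar j i) *: (E j * E i ^+ 2) = 0;
  Uq_SerreF : forall i j, i != j ->
    (qpar i j / qpar j i) *: (F_ i ^+ 2 * F_ j)
      - (qpar i j * (1 + qpar i i)) *: (F_ i * F_ j * F_ i)
      + F_ j * F_ i ^+ 2 = 0
}.
End Relations.

(* A representation of U_q on V. *)
Record Uq_rep : Type := UqRep {
  rep_gen :> gen -> 'M[F]_3;
  rep_relations : Uq_relations rep_gen
}.

Definition rep_word (rho : Uq_rep) (w : word) : 'M[F]_3 :=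
  \prod_(x <- w) rho x.

(* (rho (x) sigma)(t) for a formal sum t of pure tensors. *)
Definition rep_tens (rho sigma : Uq_rep) (t : seq (word * word)) :
    'M[F]_(3 * 3) :=
  \sum_(p <- t) rep_word rho p.1 *t rep_word sigma p.2.

(* Operators are matrices acting on column vectors: e s t sends the t-th basis
   vector to the s-th one. *)
Local Notation e s t := (delta_mx s t : 'M[F]_3).

Definition diag3 (x y z : F) : 'M[F]_3 := diag_mx (\row_j tri x y z j).

Definition rhoE (c : color) (z : F) : 'I_3 -> 'M[F]_3 :=
  match c with
  | green => tri (- (q ^+ 2 / z) *: e o3 o1) (q *: e o1 o2) (- e o2 o3)
  | red   => tri (- z^-1 *: e o2 o3) (- q ^+ 2 *: e o3 o1) ((q / Q) *: e o1 o2)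
  | blue  => tri (- (q * z)^-1 *: e o2 o1) (q *: e o3 o2) ((q / Q) *: e o1 o3)
  end.

Definition rhoF (c : color) (z : F) : 'I_3 -> 'M[F]_3 :=
  match c with
  | green => tri (- (z / q) *: e o1 o3) (Q^-1 *: e o2 o1) (- q *: e o3 o2)
  | red   => tri (- (q * z) *: e o3 o2) (- q^-1 *: e o1 o3) (e o2 o1)
  | blue  => tri (- (q ^+ 2 * z) *: e o1 o2) (Q^-1 *: e o2 o3) (e o3 o1)
  end.

Definition rhoK1 (c : color) : 'I_3 -> 'M[F]_3 :=
  match c with
  | green => tri (diag3 (Q / q) 1 q) (diag3 (q / Q) q^-1 Q^-1)
                 (diag3 1 q (Q / q))
  | red   => tri (diag3 1 q (Q / q)) (diag3 (Q / q) 1 q)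
                 (diag3 (q / Q) q^-1 Q^-1)
  | blue  => tri (diag3 (Q / q) q Q) (diag3 1 q^-1 (q / Q))
                 (diag3 (q / Q) 1 q^-1)
  end.

Definition rhoK2 (c : color) : 'I_3 -> 'M[F]_3 :=
  match c with
  | green => tri (diag3 q^-1 1 (q / Q)) (diag3 q (Q / q) Q)
                 (diag3 1 (q / Q) q^-1)
  | red   => tri (diag3 1 (q / Q) q^-1) (diag3 q^-1 1 (q / Q))
                 (diag3 q (Q / q) Q)
  | blue  => tri (diag3 q^-1 (q / Q) Q^-1) (diag3 1 (Q / q) q)
                 (diag3 q 1 (Q / q))
  end.

Definition rho_gen (c : color) (z : F) (x : gen) : 'M[F]_3 :=
  match x with
  | gE i => rhoE c z i
  | gF i => rhoF c z i
  | gK1 i => rhoK1 c i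
  | gK1V i => invmx (rhoK1 c i)
  | gK2 i => rhoK2 c i
  | gK2V i => invmx (rhoK2 c i)
  end.

Definition ket (k : basisV) : 'cV[F]_3 := delta_mx (basisV_ord k) 0.

(* The basis vector (k,l) = v_k (x) v_l. *)
Definition ket2 (k l : basisV) : 'cV[F]_(3 * 3) :=
  delta_mx (mxtens_index (basisV_ord k, basisV_ord l)) 0.

(* The matrices of the linear maps sending v_k, resp. (k,l), to f k, resp.
   f k l. *)
Definition lin1 (m : nat) (f : basisV -> 'cV[F]_m) : 'M[F]_(m, 3) :=
  \sum_(k <- basisV_seq) f k *m (ket k)^T.

Definition lin2 (m : nat) (f : basisV -> basisV -> 'cV[F]_m) :
    'M[F]_(m, 3 * 3) :=
  \sum_(k <- basisV_seq) \sum_(l <- basisV_seq) f k l *m (ket2 k l)^T.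

(* R_{g,r}(z / q^2) as a function of z *)
Definition Rgr_shifted (z : F) : 'M[F]_(3 * 3) :=
  let E := Q - q ^+ 2 * z in
  lin2 (fun k l => match k, l with
    | v1,  v1  => ket2 v1 v1 + (a / E) *: ket2 v10 v0
    | v1,  v0  => ket2 v0 v1 - (q * a / E) *: ket2 v10 v10
    | v1,  v10 => (q * Q * (1 - z) / E) *: ket2 v10 v1
    | v0,  v1  => (q * (1 - z) / E) *: ket2 v1 v0
    | v0,  v0  => ket2 v0 v0 + (a / E) *: ket2 v1 v10
    | v0,  v10 => (a * z / E) *: ket2 v1 v1 + ket2 v10 v0
    | v10, v1  => ket2 v1 v10 + (a * z / E) *: ket2 v0 v0
    | v10, v0  => (q * Q * (1 - z) / E) *: ket2 v0 v10
    | v10, v10 => - (a * Q * z / (q * E)) *: ket2 v0 v1 + Q *: ket2 v10 v10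
    end).

(* R_{b,r}(z / q) as a function of z *)
Definition Rbr_shifted (z : F) : 'M[F]_(3 * 3) :=
  let u := z^-1 in
  let D := Q - q ^+ 2 * u in
  lin2 (fun k l => match k, l with
    | v1,  v1  => ket2 v1 v1
    | v0,  v1  => ket2 v1 v0
    | v0,  v0  => ket2 v0 v0
    | v1,  v10 => ket2 v10 v1
    | v10, v0  => ket2 v0 v10
    | v10, v10 => Q *: ket2 v10 v10
    | v1,  v0  => D^-1 *: ((a * u) *: ket2 v1 v10 + (q * (1 - u)) *: ket2 v0 v1
                           + (a * u) *: ket2 v10 v0)
    | v0,  v10 => D^-1 *: (- (a * Q / q) *: ket2 v1 v10 + a *: ket2 v0 v1
                           + (q * Q * (1 - u)) *: ket2 v10 v0)
    | v10, v1  => D^-1 *: ((q * Q * (1 - u)) *: ket2 v1 v10 + a *: ket2 v0 v1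
                           - (q * a * u) *: ket2 v10 v0)
    end).

(* R_{g,b}(z / q) as a function of z *)
Definition Rgb_shifted (z : F) : 'M[F]_(3 * 3) :=
  let u := z^-1 in
  let D := Q - q ^+ 2 * u in
  lin2 (fun k l => match k, l with
    | v1,  v1  => ket2 v1 v1
    | v0,  v1  => ket2 v1 v0
    | v0,  v0  => ket2 v0 v0
    | v1,  v10 => ket2 v10 v1
    | v10, v0  => ket2 v0 v10
    | v10, v10 => Q *: ket2 v10 v10
    | v1,  v0  => D^-1 *: ((a * u) *: ket2 v1 v10 + (q * (1 - u)) *: ket2 v0 v1
                           + (a * u) *: ket2 v10 v0)
    | v0,  v10 => D^-1 *: (- (q * a * u) *: ket2 v1 v10 + a *: ket2 v0 v1
                           + (q * Q * (1 - u)) *: ket2 v10 v0)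
    | v10, v1  => D^-1 *: ((q * Q * (1 - u)) *: ket2 v1 v10 + a *: ket2 v0 v1
                           - (a * Q / q) *: ket2 v10 v0)
    end).

Definition Rgr (w : F) := Rgr_shifted (q ^+ 2 * w).
Definition Rbr (w : F) := Rbr_shifted (q * w).
Definition Rgb (w : F) := Rgb_shifted (q * w).
Definition Rrg (w : F) := invmx (Rgr w^-1).
Definition Rrb (w : F) := invmx (Rbr w^-1).
Definition Rbg (w : F) := invmx (Rgb w^-1).

(* The value on two equal colors is a placeholder. *)
Definition Rbar (i j : color) (w : F) : 'M[F]_(3 * 3) :=
  match i, j with
  | blue,  red   => Rbr w^-1
  | blue,  green => Rbg (q ^+ 4 / w)
  | red,   green => Rrg (q ^+ 4 / w)
  | red,   blue  => Rrb w^-1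
  | green, blue  => Rgb (q ^+ 4 * w)^-1
  | green, red   => Rgr (q ^+ 4 * w)^-1
  | _, _ => 1%:M
  end.

Definition Dmx : 'M[F]_(3 * 3, 3) :=
  lin1 (fun k => match k with
    | v1  => ket2 v1 v1 + ket2 v10 v0
    | v0  => ket2 v1 v10 + ket2 v0 v0
    | v10 => ket2 v0 v1 - q *: ket2 v10 v10
    end).

Definition Umx : 'M[F]_(3, 3 * 3) :=
  lin2 (fun k l => match k, l with
    | v1,  v1  | v0,  v10 => ket v1
    | v0,  v0  | v10, v1  => ket v0
    | v1,  v0  => ket v10
    | v10, v10 => - (Q / q) *: ket v10
    | _, _ => 0
    end).

End QuantumGroup.

Section RhoRelations.
Variables (F : fieldType) (q beta : F).
Local Notation Q := (Qpar q beta).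

Lemma ord3P (P : 'I_3 -> Prop) : P o1 -> P o2 -> P o3 -> forall i, P i.
Proof.
move=> P1 P2 P3 [[|[|[|//]]] lt_i3].
- by rewrite (_ : Ordinal _ = o1) //; apply: val_inj.
- by rewrite (_ : Ordinal _ = o2) //; apply: val_inj.
- by rewrite (_ : Ordinal _ = o3) //; apply: val_inj.
Qed.

Lemma mul_delta3 (k l : F) (s t u v : 'I_3) :
  (k *: delta_mx s t) * (l *: delta_mx u v) =
  (k * l * (t == u)%:R) *: delta_mx s v :> 'M[F]_3.
Proof.
rewrite -scalerAl -scalerAr scalerA -[delta_mx s t * _]/(_ *m _).
by rewrite mul_delta_mx_cond -[RHS]scalerA scaler_nat.
Qed.

Lemma triE (T : Type) (x y z : T) :
  (tri x y z o1 = x) * (tri x y z o2 = y) * (tri x y z o3 = z).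
Proof. by []. Qed.

Definition posE (c : color) : 'I_3 -> 'I_3 * 'I_3 :=
  match c with
  | green => tri (o3, o1) (o1, o2) (o2, o3)
  | red => tri (o2, o3) (o3, o1) (o1, o2)
  | blue => tri (o2, o1) (o3, o2) (o1, o3)
  end.

Definition coefE (c : color) (z : F) : 'I_3 -> F :=
  match c with
  | green => tri (- (q ^+ 2 / z)) q (-1)
  | red => tri (- z^-1) (- q ^+ 2) (q / Q)
  | blue => tri (- (q * z)^-1) q (q / Q)
  end.

Definition coefF (c : color) (z : F) : 'I_3 -> F :=
  match c with
  | green => tri (- (z / q)) Q^-1 (- q)
  | red => tri (- (q * z)) (- q^-1) 1
  | blue => tri (- (q ^+ 2 * z)) Q^-1 1
  end.

Definition diagK1 (c : color) : 'I_3 -> 'I_3 -> F :=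
  match c with
  | green => tri (tri (Q / q) 1 q) (tri (q / Q) q^-1 Q^-1) (tri 1 q (Q / q))
  | red => tri (tri 1 q (Q / q)) (tri (Q / q) 1 q) (tri (q / Q) q^-1 Q^-1)
  | blue => tri (tri (Q / q) q Q) (tri 1 q^-1 (q / Q)) (tri (q / Q) 1 q^-1)
  end.

Definition diagK2 (c : color) : 'I_3 -> 'I_3 -> F :=
  match c with
  | green => tri (tri q^-1 1 (q / Q)) (tri q (Q / q) Q) (tri 1 (q / Q) q^-1)
  | red => tri (tri 1 (q / Q) q^-1) (tri q^-1 1 (q / Q)) (tri q (Q / q) Q)
  | blue => tri (tri q^-1 (q / Q) Q^-1) (tri 1 (Q / q) q) (tri q 1 (Q / q))
  end.

Local Notation dg d := (diag_mx (\row_j d j) : 'M[F]_3).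

Lemma rhoEE c z i : rhoE q beta c z i =
  coefE c z i *: delta_mx (posE c i).1 (posE c i).2.
Proof. by move: i; case: c; apply: ord3P; rewrite /tri //= ?scaleN1r. Qed.

Lemma rhoFE c z i : rhoF q beta c z i =
  coefF c z i *: delta_mx (posE c i).2 (posE c i).1.
Proof. by move: i; case: c; apply: ord3P; rewrite /tri //= ?scale1r. Qed.

Lemma rhoK1E c i : rhoK1 q beta c i = dg (diagK1 c i).
Proof. by move: i; case: c; apply: ord3P. Qed.

Lemma rhoK2E c i : rhoK2 q beta c i = dg (diagK2 c i).
Proof. by move: i; case: c; apply: ord3P. Qed.

Lemma dg_inv (d : 'I_3 -> F) : (forall i, d i != 0) ->
  [/\ dg d * invmx (dg d) = 1, invmx (dg d) * dg d = 1 &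
      invmx (dg d) = dg (fun i => (d i)^-1)].
Proof.
move=> d0; have dd : dg d *m dg (fun i => (d i)^-1) = 1%:M.
  rewrite mulmx_diag -diag_const_mx; congr diag_mx.
  by apply/rowP => i; rewrite !mxE mulfV.
have [ud _] := mulmx1_unit dd.
split; [exact: mulmxV | exact: mulVmx|].
by rewrite -[LHS]mulmx1 -dd mulKmx.
Qed.

Lemma dg_delta (d d' : 'I_3 -> F) (k : F) (s t : 'I_3) :
  dg d * (k *: delta_mx s t) * dg d' = (d s * d' t * k) *: delta_mx s t.
Proof.
rewrite -[LHS]/(_ *m _ *m _) mul_mx_diag mul_diag_mx.
apply/matrixP => i j; rewrite !mxE.
case: (i =P s) => [->|_]; case: (j =P t) => [->|_];
  rewrite /= ?(mulr0, mul0r, mulr1) //.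
by rewrite mulrAC.
Qed.

Lemma dg_sub (k : F) (d d' : 'I_3 -> F) :
  k *: (dg d - dg d') = dg (fun i => k * (d i - d' i)).
Proof.
rewrite -raddfB -linearZ; congr diag_mx; by apply/rowP => i; rewrite !mxE.
Qed.

Lemma delta_sub (k : F) (s t : 'I_3) :
  k *: delta_mx s s - k *: delta_mx t t =
  dg (fun i => k * ((i == s)%:R - (i == t)%:R)).
Proof.
apply/matrixP => i j; rewrite !mxE -mulrBr -mulrnAr; congr (k * _).
have [<-|ne] := eqVneq i j; first by rewrite !andbb.
suff nd r : (i == r) && (j == r) = false by rewrite !nd subrr.
by apply/andP => -[/eqP ir /eqP jr]; rewrite ir jr eqxx in ne.
Qed.

Section Nonzero.
Variables (c : color) (z : F).
Hypotheses (q0 : q != 0) (Q0 : Q != 0) (Qq : Q - q ^+ 2 != 0) (z0 : z != 0).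

Lemma Qq' : q ^+ 2 - Q != 0. Proof. by rewrite -oppr_eq0 opprB. Qed.

Ltac nz := repeat (first [apply/andP; split | apply: mulf_neq0
  | rewrite invr_eq0 | rewrite mulN1r | exact: oner_neq0 | assumption | exact: Qq']).

Lemma diagK1_neq0 i s : diagK1 c i s != 0.
Proof.
by move: i s; case: c; do 2!apply: ord3P; rewrite /= ?triE /=; nz.
Qed.

Lemma diagK2_neq0 i s : diagK2 c i s != 0.
Proof.
by move: i s; case: c; do 2!apply: ord3P; rewrite /= ?triE /=; nz.
Qed.

Lemma K1_posE i j :
  diagK1 c i (posE c j).1 / diagK1 c i (posE c j).2 = qpar q beta i j.
Proof.
rewrite /qpar; move: i j; case: c; do 2!apply: ord3P; rewrite /= ?triE /=;
  field; nz.
Qed.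

Lemma K2_posE i j :
  (diagK2 c i (posE c j).1)^-1 * diagK2 c i (posE c j).2 =
  (qpar q beta j i)^-1.
Proof.
rewrite /qpar; move: i j; case: c; do 2!apply: ord3P; rewrite /= ?triE /=;
  field; nz.
Qed.

Lemma rho_EE i j :
  rhoE q beta c z i * rhoE q beta c z j * rhoE q beta c z i = 0.
Proof.
rewrite !rhoEE !mul_delta3.
by move: i j; case: c; do 2!apply: ord3P; rewrite /= ?triE /= ?(mulr0, mul0r, scale0r).
Qed.

Lemma rho_FF i j :
  rhoF q beta c z i * rhoF q beta c z j * rhoF q beta c z i = 0.
Proof.
rewrite !rhoFE !mul_delta3.
by move: i j; case: c; do 2!apply: ord3P; rewrite /= ?triE /= ?(mulr0, mul0r, scale0r).
Qed.

Lemma rho_E2 i : rhoE q beta c z i ^+ 2 = 0.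
Proof.
rewrite expr2 !rhoEE !mul_delta3.
by move: i; case: c; apply: ord3P; rewrite /= ?triE /= ?(mulr0, mul0r, scale0r).
Qed.

Lemma rho_F2 i : rhoF q beta c z i ^+ 2 = 0.
Proof.
rewrite expr2 !rhoFE !mul_delta3.
by move: i; case: c; apply: ord3P; rewrite /= ?triE /= ?(mulr0, mul0r, scale0r).
Qed.

Lemma rho_EF i j : i != j ->
  rhoE q beta c z i * rhoF q beta c z j = 0 /\
  rhoF q beta c z j * rhoE q beta c z i = 0.
Proof.
rewrite !rhoFE !rhoEE !mul_delta3.
by move: i j; case: c; do 2!apply: ord3P; rewrite /= ?eqxx ?triE //= ?(mulr0, scale0r).
Qed.

Lemma rho_EFii i s : coefE c z i * coefF c z i *
    ((s == (posE c i).1)%:R - (s == (posE c i).2)%:R) =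
  qpar q beta i i / (qpar q beta i i - 1) *
    (diagK1 c i s - (diagK2 c i s)^-1).
Proof.
rewrite /qpar; move: i s; case: c; do 2!apply: ord3P;
  rewrite /= ?triE /= ?eqxx /=; field; nz.
Qed.

Lemma rho_relations_aux : Uq_relations q beta (rho_gen q beta c z).
Proof.
have [u1 u1' u1E] := all_and3 (fun i => dg_inv (diagK1_neq0 i)).
have [u2 u2' u2E] := all_and3 (fun i => dg_inv (diagK2_neq0 i)).
split=> [i|i|i|i|i j|i j|i j|i j|i j|i j|i j|i j|i j ij|i j ij];
  rewrite /rho_gen.
- by rewrite rhoK1E.
- by rewrite rhoK1E.
- by rewrite rhoK2E.
- by rewrite rhoK2E.
- by rewrite !rhoK1E; apply: diag_mxC.
- by rewrite rhoK1E rhoK2E; apply: diag_mxC.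
- by rewrite !rhoK2E; apply: diag_mxC.
- by rewrite rhoK1E u1E rhoEE dg_delta K1_posE scalerA.
- by rewrite rhoK2E u2E rhoEE dg_delta K2_posE scalerA.
- by rewrite rhoK1E u1E rhoFE dg_delta -K1_posE invfM invrK [_^-1 * _]mulrC
    scalerA.
- rewrite rhoK2E u2E rhoFE dg_delta scalerA -[qpar _ _ _ _]invrK -K2_posE.
  by rewrite invfM invrK [_^-1 * _]mulrC.
- case: (i =P j) => [<-|/eqP ij]; last first.
    by have [-> ->] := rho_EF ij; rewrite subrr.
  rewrite rhoK1E rhoK2E u2E dg_sub rhoEE rhoFE !mul_delta3 !eqxx !mulr1.
  rewrite [coefF _ _ _ * _]mulrC delta_sub; congr diag_mx.
  by apply/rowP => s; rewrite !mxE rho_EFii.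
- by rewrite rho_E2 rho_EE ?mul0r ?mulr0 ?scaler0 ?subr0 ?addr0 //.
- by rewrite rho_F2 rho_FF ?mul0r ?mulr0 ?scaler0 ?subr0 ?addr0.
Qed.

End Nonzero.
End RhoRelations.

Lemma rho_relations (F : fieldType) (q beta : F) (c : color) (z : F) :
  q != 0 -> Qpar q beta != 0 -> Qpar q beta != q ^+ 2 -> z != 0 ->
  Uq_relations q beta (rho_gen q beta c z).
Proof. by rewrite -(subr_eq0 _ (q ^+ 2)); apply: rho_relations_aux. Qed.

Lemma Qpar_tofrac (R : idomainType) (x y : R) :
  Qpar (tofrac x) (tofrac y) = tofrac (x ^+ 2 + y - x ^+ 2 * y).
Proof. by rewrite tofracB tofracD tofracM tofracXn. Qed.

Lemma Qpar_eq_sqr (F : fieldType) (q beta : F) :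
  (Qpar q beta == q ^+ 2) = (apar q beta == 0).
Proof. by rewrite -subr_eq0; congr (_ == _); rewrite /Qpar /apar; ring. Qed.

Lemma apar_tofrac (R : idomainType) (x y : R) :
  apar (tofrac x) (tofrac y) = tofrac (y * (1 - x ^+ 2)).
Proof. by rewrite tofracM tofracB tofrac1 tofracXn. Qed.

(* The field Q(q, beta, z, z1, z2) of rational functions. *)
Definition K : fieldType := {fraction {mpoly rat[5]}}.

Definition mvar (i : nat) (i_lt5 : (i < 5)%N) : {mpoly rat[5]} :=
  'X_(Ordinal i_lt5).

Definition indet (i : nat) (i_lt5 : (i < 5)%N) : K := tofrac (mvar i_lt5).

Definition q : K := @indet 0 isT.
Definition beta : K := @indet 1 isT.
Definition z : K := @indet 2 isT.
Definition z1 : K := @indet 3 isT.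
Definition z2 : K := @indet 4 isT.

Lemma tofrac_neq0 (p : {mpoly rat[5]}) (v : 'I_5 -> rat) :
  p.@[v] != 0 -> (tofrac p : K) != 0.
Proof.
by apply: contra_neq => /eqP; rewrite tofrac_eq0 => /eqP->; rewrite meval0.
Qed.

Lemma mvarE (v : 'I_5 -> rat) (i : nat) (i_lt5 : (i < 5)%N) :
  (mvar i_lt5).@[v] = v (Ordinal i_lt5).
Proof. exact: mevalXU. Qed.

Lemma indet_neq0 (i : nat) (i_lt5 : (i < 5)%N) : indet i_lt5 != 0.
Proof. by apply: (@tofrac_neq0 _ (fun=> 1)); rewrite mvarE oner_neq0. Qed.

Lemma q_neq0 : q != 0. Proof. exact: indet_neq0. Qed.
Lemma z_neq0 : z != 0. Proof. exact: indet_neq0. Qed.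
Lemma z1_neq0 : z1 != 0. Proof. exact: indet_neq0. Qed.
Lemma z2_neq0 : z2 != 0. Proof. exact: indet_neq0. Qed.

Lemma Qpar_neq0 : Qpar q beta != 0.
Proof.
rewrite [Qpar _ _]Qpar_tofrac; apply: (@tofrac_neq0 _ (fun i => i%:R)).
by rewrite mevalB mevalD expr2 !mevalM !mvarE.
Qed.

Lemma Qpar_neq_sqr : Qpar q beta != q ^+ 2.
Proof.
rewrite [_ == _]Qpar_eq_sqr [apar _ _]apar_tofrac.
apply: (@tofrac_neq0 _ (fun i => i%:R)).
by rewrite expr2 mevalM mevalB meval1 mevalM !mvarE.
Qed.

Lemma qz_neq0 : q * z != 0.
Proof. exact: mulf_neq0 q_neq0 z_neq0. Qed.

Lemma qVz_neq0 : q^-1 * z != 0.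
Proof. exact: mulf_neq0 (invr_neq0 q_neq0) z_neq0. Qed.

Lemma qV2z_neq0 : q ^- 2 * z != 0.
Proof. exact: mulf_neq0 (invr_neq0 (expf_neq0 2 q_neq0)) z_neq0. Qed.

(* rho_c^x, defined for x != 0 *)
Definition rho (c : color) (x : K) (x_neq0 : x != 0) : Uq_rep q beta :=
  UqRep (rho_relations c q_neq0 Qpar_neq0 Qpar_neq_sqr x_neq0).
Arguments rho c x x_neq0 : clear implicits.

(* Main.v *)
Require Import Defs.
From mathcomp Require Import all_boot all_order all_algebra.
From mathcomp Require Import mpoly mxtens ring.

Import GRing.Theory.
Local Open Scope ring_scope.

Set Implicit Arguments.
Unset Strict Implicit.
Unset Printing Implicit Defensive.

(** Every operator in the theorem is a sparse matrix whose entries are rational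
    functions of [q], [Q] and the spectral parameters, so each of the identities
    is a finite family of identities between such functions.  The point is to
    organize the verification so that it stays small.

    A vector is represented by a formal linear combination of labelled basis
    vectors ([comb]), an operator by the combinations to which it sends the
    basis vectors ([tabulates]).  Tables compose ([tabulates_mul]), and tensor
    products and coproducts of tabulated representations are tabulated
    ([tabulates_Delta]).  Two composite operators are therefore equal as soon as
    the coefficients of their tables agree ([intertwines_coef]).  These
    coefficients are computed by reduction; by weight considerations most of
    them are empty sums on both sides, and [field] decides the others.

    For the R-matrices this is done over an arbitrary field, after solving for
    one of the two evaluation parameters in terms of the other one and of the
    argument of the R-matrix ([Rgr_intertwines], [Rbr_intertwines],
    [Rgb_intertwines]).  The normalization of the bars is what makes this
    relation hold for the parameters [x], [y] and the argument [y / x]; it also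
    makes the barred R-matrices of [(j, i)] at [w] inverse to those of [(i, j)]
    at [w^-1].  So the three remaining pairs of colors follow by inverting an
    intertwiner ([intertwines_inv]), once the first three matrices are known to
    be invertible.  Explicit inverses show this: the blocks of the
    green-red matrix have size at most 2, with determinants governed by
    [(Q - q^2 z)^2 - a^2 z = (1 - z) (Q^2 - q^4 z)], where [a = Q - q^2], and
    the other two have a single block of size 3, whose determinant is
    [(q^4 - Q^2 u) / (q (Q - q^2 u))] up to sign.

    Apart from powers of the indeterminates, the denominators and determinants
    involved are nonzero because they do not vanish at [q = 0], [beta = 1],
    where [Q = 1] ([indet_generic]). *)

(** * Formal linear combinations and tables of operators *)

Section Combinations.
Variable F : fieldType.

Definition comb (T : Type) := seq (F * T).

Definition eval (T : Type) (n : nat) (e : T -> 'cV[F]_n) (v : comb T) :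
    'cV[F]_n :=
  \sum_(x <- v) x.1 *: e x.2.

Definition scale (T : Type) (c : F) (v : comb T) : comb T :=
  [seq (c * x.1, x.2) | x <- v].

Definition bind (T T' : Type) (f : T -> comb T') (v : comb T) : comb T' :=
  flatten [seq scale x.1 (f x.2) | x <- v].

Definition tensor (T T' : Type) (v : comb T) (w : comb T') : comb (T * T') :=
  flatten [seq [seq (x.1 * y.1, (x.2, y.2)) | y <- w] | x <- v].

Definition tabulates (T T' : Type) (m n : nat) (e : T -> 'cV[F]_m)
    (e' : T' -> 'cV[F]_n) (A : 'M[F]_(n, m)) (f : T -> comb T') : Prop :=
  forall t, A *m e t = eval e' (f t).

Lemma eval_cat (T : Type) m (e : T -> 'cV[F]_m) v w :
  eval e (v ++ w) = eval e v + eval e w.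
Proof. exact: big_cat. Qed.

Lemma eval_scale (T : Type) m (e : T -> 'cV[F]_m) c v :
  eval e (scale c v) = c *: eval e v.
Proof.
by rewrite /eval big_map scaler_sumr; apply: eq_bigr => x _; rewrite scalerA.
Qed.

Lemma eval1 (T : Type) m (e : T -> 'cV[F]_m) t : eval e [:: (1, t)] = e t.
Proof. by rewrite /eval big_seq1 scale1r. Qed.

Lemma eval_bind (T T' : Type) (m n : nat) (e : T -> 'cV[F]_m)
    (e' : T' -> 'cV[F]_n) A f v :
  tabulates e e' A f -> A *m eval e v = eval e' (bind f v).
Proof.
move=> Af; rewrite /eval mulmx_sumr big_flatten big_map.
apply: eq_bigr => x _; rewrite -scalemxAr Af.
by rewrite -eval_scale.
Qed.

Lemma tabulates_mul (T T' T'' : Type) (m n p : nat) (e : T -> 'cV[F]_m)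
    (e' : T' -> 'cV[F]_n) (e'' : T'' -> 'cV[F]_p) A B f g :
  tabulates e e' A f -> tabulates e' e'' B g ->
  tabulates e e'' (B *m A) (fun t => bind g (f t)).
Proof. by move=> Af Bg t; rewrite -mulmxA Af; apply: eval_bind. Qed.

(** The recursion returns the literal [0] on a combination without the label
    [s], so that reduction alone settles the coefficients that are absent. *)
Fixpoint coef (T : Type) (eqT : rel T) (v : comb T) (s : T) : F :=
  if v is x :: v' then
    if eqT x.2 s then x.1 + coef eqT v' s else coef eqT v' s
  else 0.

Lemma eval_coef (T : Type) (eqT : rel T) (enumT : seq T) (n : nat)
    (e : T -> 'cV[F]_n) v :
  (forall t, \sum_(s <- enumT | eqT t s) e s = e t) ->
  eval e v = \sum_(s <- enumT) coef eqT v s *: e s.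
Proof.
move=> enumP; elim: v => [|x v IHv].
  by rewrite /eval big_nil big1 // => s _; rewrite scale0r.
rewrite /eval big_cons [X in _ + X]IHv -enumP scaler_sumr big_mkcond -big_split.
apply: eq_bigr => s _ /=; case: (eqT _ _); rewrite ?add0r //.
by rewrite scalerDl.
Qed.

Definition eqV (k l : basisV) : bool :=
  match k, l with v1, v1 | v0, v0 | v10, v10 => true | _, _ => false end.

Definition eqVV (s t : basisV * basisV) : bool := eqV s.1 t.1 && eqV s.2 t.2.

Definition ketp (t : basisV * basisV) : 'cV[F]_(3 * 3) := ket2 F t.1 t.2.

Lemma eval_eqV n (e : basisV -> 'cV[F]_n) v w :
  (forall s, coef eqV v s = coef eqV w s) -> eval e v = eval e w.
Proof.
move=> vw.
have enumP t : \sum_(s <- basisV_seq | eqV t s) e s = e t.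
  by case: t; rewrite !big_cons big_nil /= ?addr0.
by rewrite !(eval_coef _ enumP); apply: eq_bigr => s _; rewrite vw.
Qed.

Lemma eval_eqVV n (e : basisV * basisV -> 'cV[F]_n) v w :
  (forall s, coef eqVV v s = coef eqVV w s) -> eval e v = eval e w.
Proof.
move=> vw; pose enum := [seq (k, l) | k <- basisV_seq, l <- basisV_seq].
have enumP t : \sum_(s <- enum | eqVV t s) e s = e t.
  by case: t => -[] []; rewrite !big_cons big_nil /= ?addr0.
by rewrite !(eval_coef _ enumP); apply: eq_bigr => s _; rewrite vw.
Qed.

(** * The labelled bases of the space and of its tensor square *)

Lemma ketP n (A B : 'M[F]_(n, 3)) :
  (forall k, A *m ket F k = B *m ket F k) -> A = B.
Proof.
move=> AB; apply: trmx_inj; apply/row_matrixP => j; rewrite -!tr_col.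
congr _^T; move: j; apply: ord3P; rewrite !colE.
- exact: (AB v1).
- exact: (AB v0).
- exact: (AB v10).
Qed.

Lemma ketpP n (A B : 'M[F]_(n, 3 * 3)) :
  (forall t, A *m ketp t = B *m ketp t) -> A = B.
Proof.
move=> AB; apply: trmx_inj; apply/row_matrixP => ij; rewrite -!tr_col.
congr _^T; case: (mxtens_indexP ij) => i j; rewrite !colE.
move: i j; do 2!apply: ord3P.
- exact: (AB (v1, v1)).
- exact: (AB (v1, v0)).
- exact: (AB (v1, v10)).
- exact: (AB (v0, v1)).
- exact: (AB (v0, v0)).
- exact: (AB (v0, v10)).
- exact: (AB (v10, v1)).
- exact: (AB (v10, v0)).
- exact: (AB (v10, v10)).
Qed.

Lemma ketpE k l : ketp (k, l) = ket F k *t ket F l.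
Proof.
apply/matrixP => ij j; case: (mxtens_indexP ij) => i i'.
rewrite !ord1 !mxE (can_eq (@mxtens_indexK 3 3)) !mxtens_indexK /= xpair_eqE.
by rewrite !ord1 !andbT -natrM mulnb.
Qed.

Lemma tens_eval (v w : comb basisV) :
  eval (@ket F) v *t eval (@ket F) w = eval ketp (tensor v w).
Proof.
rewrite {1 3}/eval big_flatten big_map.
transitivity (\sum_(x <- v) (x.1 *: ket F x.2) *t eval (@ket F) w).
  elim/big_ind2: _ => [|A A' B B' <- <-|//]; first exact: tens0mx.
  by apply/matrixP => i j; rewrite !mxE mulrDl.
apply: eq_bigr => x _; rewrite /eval big_map.
elim/big_ind2: _ => [|A A' B B' <- <-|y _]; first exact: tensmx0.
  by apply/matrixP => i j; rewrite !mxE mulrDr.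
by rewrite ketpE; apply/matrixP => i j; rewrite !mxE mulrACA.
Qed.

Lemma tabulates_tens A B f g :
  tabulates (@ket F) (@ket F) A f -> tabulates (@ket F) (@ket F) B g ->
  tabulates ketp ketp (A *t B) (fun t => tensor (f t.1) (g t.2)).
Proof.
move=> Af Bg [k l]; rewrite ketpE -tens_eval -Af -Bg.
(* The product of two column vectors has 1 * 1 columns, which unification does
   not find from the type of a column vector. *)
exact: (@tensmx_mul F 3 3 3 3 1 1 A B).
Qed.

Lemma ket_dot (k k' : basisV) : (ket F k)^T *m ket F k' = (eqV k k')%:R%:M.
Proof.
rewrite trmx_delta mul_delta_mx_cond; case: k; case: k';
  by apply/matrixP => i j; rewrite !ord1 !mxE /= ?mulr0n ?mulr1n.
Qed.

Lemma ket2_dot (k l k' l' : basisV) :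
  (ket2 F k l)^T *m ket2 F k' l' = (eqV k k' && eqV l l')%:R%:M.
Proof.
rewrite trmx_delta mul_delta_mx_cond (can_eq (@mxtens_indexK 3 3)) xpair_eqE.
case: k; case: k'; case: l; case: l';
  by apply/matrixP => i j; rewrite !ord1 !mxE /= ?mulr0n ?mulr1n.
Qed.

Lemma lin1_ket n (f : basisV -> 'cV[F]_n) k : lin1 f *m ket F k = f k.
Proof.
rewrite /lin1 !big_cons !big_nil !addr0 !mulmxDl -!mulmxA !ket_dot.
by case: k; rewrite /= !mul_mx_scalar ?scale0r ?scale1r ?addr0 ?add0r.
Qed.

Lemma lin2_ket2 n (f : basisV -> basisV -> 'cV[F]_n) k l :
  lin2 f *m ket2 F k l = f k l.
Proof.
rewrite /lin2 !big_cons !big_nil !addr0 !mulmxDl -!mulmxA !ket2_dot.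
by case: k; case: l; rewrite /= !mul_mx_scalar ?scale0r ?scale1r ?addr0 ?add0r.
Qed.

End Combinations.

(** * Tables of the representations and of their coproducts *)

Section Operators.
Variables (F : fieldType) (q beta : F).
Local Notation Q := (Qpar q beta).
Local Notation a := (Q - q ^+ 2).

Definition label (i : 'I_3) : basisV := tri v1 v0 v10 i.

Definition matrix_unit (c : F) (st : 'I_3 * 'I_3) (k : basisV) :
    comb F basisV :=
  if eqV k (label st.2) then [:: (c, label st.1)] else [::].

Definition rho_tab (c : color) (z : F) (x : gen) (k : basisV) :
    comb F basisV :=
  match x with
  | gE i => matrix_unit (Defs.coefE q beta c z i) (posE c i) k
  | gF i =>
      matrix_unit (Defs.coefF q beta c z i) ((posE c i).2, (posE c i).1) k
  | gK1 i => [:: (diagK1 q beta c i (basisV_ord k), k)]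
  | gK1V i => [:: ((diagK1 q beta c i (basisV_ord k))^-1, k)]
  | gK2 i => [:: (diagK2 q beta c i (basisV_ord k), k)]
  | gK2V i => [:: ((diagK2 q beta c i (basisV_ord k))^-1, k)]
  end.

Fixpoint word_tab (tab : gen -> basisV -> comb F basisV) (w : word)
    (k : basisV) : comb F basisV :=
  if w is x :: w' then bind (tab x) (word_tab tab w' k) else [:: (1, k)].

Definition Delta_tab (tab tab' : gen -> basisV -> comb F basisV) (x : gen)
    (t : basisV * basisV) : comb F (basisV * basisV) :=
  flatten
    [seq tensor (word_tab tab p.1 t.1) (word_tab tab' p.2 t.2) | p <- Delta x].

Lemma tabulates_unit c (st : 'I_3 * 'I_3) :
  tabulates (@ket F) (@ket F) (c *: delta_mx st.1 st.2) (matrix_unit c st).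
Proof.
case: st => s t k; rewrite /matrix_unit /= -scalemxAl mul_delta_mx_cond.
by case: k; move: s t; do 2!apply: ord3P;
  rewrite /eval ?big_seq1 ?big_nil //= ?scaler0.
Qed.

Lemma tabulates_diag (d : 'I_3 -> F) :
  tabulates (@ket F) (@ket F) (diag_mx (\row_j d j))
    (fun k => [:: (d (basisV_ord k), k)]).
Proof.
move=> k; rewrite /eval big_seq1 /= mul_diag_mx; apply/matrixP => i j.
by rewrite !mxE; case: eqP => [->//|_]; rewrite !mulr0.
Qed.

Lemma tabulates_rho_gen c z x : q != 0 -> Q != 0 ->
  tabulates (@ket F) (@ket F) (rho_gen q beta c z x) (rho_tab c z x).
Proof.
move=> q0 Q0; case: x => i /=.
- by rewrite rhoEE; apply: tabulates_unit.
- rewrite rhoFE; exact: (tabulates_unit _ (_, _)).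
- by rewrite rhoK1E; apply: tabulates_diag.
- rewrite rhoK1E; have [_ _ ->] := dg_inv (diagK1_neq0 c q0 Q0 i).
  exact: tabulates_diag (fun j => (diagK1 q beta c i j)^-1).
- by rewrite rhoK2E; apply: tabulates_diag.
- rewrite rhoK2E; have [_ _ ->] := dg_inv (diagK2_neq0 c q0 Q0 i).
  exact: tabulates_diag (fun j => (diagK2 q beta c i j)^-1).
Qed.

Lemma tabulates_rep (rho : Uq_rep q beta) c z x : q != 0 -> Q != 0 ->
  rho =1 rho_gen q beta c z ->
  tabulates (@ket F) (@ket F) (rho x) (rho_tab c z x).
Proof. by move=> q0 Q0 ->; apply: tabulates_rho_gen. Qed.

Lemma tabulates_word (rho : Uq_rep q beta) tab w :
  (forall x, tabulates (@ket F) (@ket F) (rho x) (tab x)) ->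
  tabulates (@ket F) (@ket F) (rep_word rho w) (word_tab tab w).
Proof.
move=> rhoP; rewrite /rep_word; elim: w => [|x w IHw] k /=.
  by rewrite big_nil mul1mx eval1.
by rewrite big_cons -mulmxA IHw; apply: eval_bind.
Qed.

Lemma tabulates_Delta (rho sigma : Uq_rep q beta) tab tab' x :
  (forall y, tabulates (@ket F) (@ket F) (rho y) (tab y)) ->
  (forall y, tabulates (@ket F) (@ket F) (sigma y) (tab' y)) ->
  tabulates (@ketp F) (@ketp F) (rep_tens rho sigma (Delta x))
    (Delta_tab tab tab' x).
Proof.
move=> rhoP sigmaP; rewrite /rep_tens /Delta_tab => t.
elim: (Delta x) => [|p s IHs]; first by rewrite big_nil mul0mx /eval big_nil.
rewrite big_cons mulmxDl IHs /= eval_cat; congr (_ + _).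
exact: (tabulates_tens (tabulates_word _ rhoP) (tabulates_word _ sigmaP)).
Qed.

(** * Tables of the R-matrices, of their inverses, and of U and D *)

(** With [a] expressed through [Q], the table entries involve [q], [Q] and the
    spectral parameter only, so [field] can treat [Q] as a variable. *)
Lemma aparE : apar q beta = a.
Proof. by rewrite /apar /Qpar; ring. Qed.

Definition Rgr_tab (z : F) (t : basisV * basisV) : comb F (basisV * basisV) :=
  let E := Q - q ^+ 2 * z in
  match t with
  | (v1,  v1)  => [:: (1, (v1, v1)); (a / E, (v10, v0))]
  | (v1,  v0)  => [:: (1, (v0, v1)); (- (q * a / E), (v10, v10))]
  | (v1,  v10) => [:: (q * Q * (1 - z) / E, (v10, v1))]
  | (v0,  v1)  => [:: (q * (1 - z) / E, (v1, v0))]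
  | (v0,  v0)  => [:: (1, (v0, v0)); (a / E, (v1, v10))]
  | (v0,  v10) => [:: (a * z / E, (v1, v1)); (1, (v10, v0))]
  | (v10, v1)  => [:: (1, (v1, v10)); (a * z / E, (v0, v0))]
  | (v10, v0)  => [:: (q * Q * (1 - z) / E, (v0, v10))]
  | (v10, v10) => [:: (- (a * Q * z / (q * E)), (v0, v1)); (Q, (v10, v10))]
  end.

Definition Rbr_tab (u : F) (t : basisV * basisV) : comb F (basisV * basisV) :=
  let D := Q - q ^+ 2 * u in
  match t with
  | (v1,  v0)  => [:: (a * u / D, (v1, v10)); (q * (1 - u) / D, (v0, v1));
                      (a * u / D, (v10, v0))]
  | (v0,  v10) => [:: (- (a * Q / q) / D, (v1, v10)); (a / D, (v0, v1));
                      (q * Q * (1 - u) / D, (v10, v0))]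
  | (v10, v1)  => [:: (q * Q * (1 - u) / D, (v1, v10)); (a / D, (v0, v1));
                      (- (q * a * u) / D, (v10, v0))]
  | (v10, v10) => [:: (Q, (v10, v10))]
  | (k, l) => [:: (1, (l, k))]
  end.

Definition Rgb_tab (u : F) (t : basisV * basisV) : comb F (basisV * basisV) :=
  let D := Q - q ^+ 2 * u in
  match t with
  | (v1,  v0)  => [:: (a * u / D, (v1, v10)); (q * (1 - u) / D, (v0, v1));
                      (a * u / D, (v10, v0))]
  | (v0,  v10) => [:: (- (q * a * u) / D, (v1, v10)); (a / D, (v0, v1));
                      (q * Q * (1 - u) / D, (v10, v0))]
  | (v10, v1)  => [:: (q * Q * (1 - u) / D, (v1, v10)); (a / D, (v0, v1));
                      (- (a * Q / q) / D, (v10, v0))]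
  | (v10, v10) => [:: (Q, (v10, v10))]
  | (k, l) => [:: (1, (l, k))]
  end.

(** The inverse of each weight block, in which the factor [N] of the
    determinants comes from [E^2 - a^2 z = N]. *)
Definition Rgr_inv_tab (z : F) (t : basisV * basisV) :
    comb F (basisV * basisV) :=
  let E := Q - q ^+ 2 * z in
  let N := (1 - z) * (Q ^+ 2 - q ^+ 4 * z) in
  match t with
  | (v1,  v1)  => [:: (E ^+ 2 / N, (v1, v1)); (- (a * E / N), (v0, v10))]
  | (v10, v0)  => [:: (- (a * z * E / N), (v1, v1)); (E ^+ 2 / N, (v0, v10))]
  | (v0,  v0)  => [:: (E ^+ 2 / N, (v0, v0)); (- (a * E / N), (v10, v1))]
  | (v1,  v10) => [:: (- (a * z * E / N), (v0, v0)); (E ^+ 2 / N, (v10, v1))]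
  | (v0,  v1)  => [:: (E ^+ 2 / N, (v1, v0));
                      (q * a * E / (Q * N), (v10, v10))]
  | (v10, v10) => [:: (a * z * E / (q * N), (v1, v0));
                      (E ^+ 2 / (Q * N), (v10, v10))]
  | (v10, v1)  => [:: (E / (q * Q * (1 - z)), (v1, v10))]
  | (v1,  v0)  => [:: (E / (q * (1 - z)), (v0, v1))]
  | (v0,  v10) => [:: (E / (q * Q * (1 - z)), (v10, v0))]
  end.

(** At [u = Q / q^2] the numerator of the block of size 3 has rank 1, so
    [Q - q^2 u] divides its cofactors, and its square divides the determinant;
    only the remaining factor [G] is left in the denominators. *)
Definition Rbr_inv_tab (u : F) (t : basisV * basisV) :
    comb F (basisV * basisV) :=
  let G := q ^+ 4 - Q ^+ 2 * u in
  match t with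
  | (v1,  v10) => [:: (- (q ^+ 2 * a / G), (v1, v0));
                      (q * a * u / G, (v0, v10));
                      (q * (q ^+ 2 - Q * u) / G, (v10, v1))]
  | (v0,  v1)  => [:: (q * Q * (q ^+ 2 - Q * u) / G, (v1, v0));
                      (- (q ^+ 2 * a * u / G), (v0, v10));
                      (- (a * Q * u / G), (v10, v1))]
  | (v10, v0)  => [:: (- (a * Q / G), (v1, v0));
                      (q * (q ^+ 2 - Q * u) / G, (v0, v10));
                      (q * a / G, (v10, v1))]
  | (v10, v10) => [:: (Q^-1, (v10, v10))]
  | (k, l) => [:: (1, (l, k))]
  end.

(** The block of the green-blue matrix is obtained from that of the blue-red
    one by exchanging the inputs [(0,10)] and [(10,1)] and the outputs [(1,10)]
    and [(10,0)]; its inverse undergoes the reverse exchange. *)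
Definition Rgb_inv_tab (u : F) (t : basisV * basisV) :
    comb F (basisV * basisV) :=
  let G := q ^+ 4 - Q ^+ 2 * u in
  match t with
  | (v10, v0)  => [:: (- (q ^+ 2 * a / G), (v1, v0));
                      (q * a * u / G, (v10, v1));
                      (q * (q ^+ 2 - Q * u) / G, (v0, v10))]
  | (v0,  v1)  => [:: (q * Q * (q ^+ 2 - Q * u) / G, (v1, v0));
                      (- (q ^+ 2 * a * u / G), (v10, v1));
                      (- (a * Q * u / G), (v0, v10))]
  | (v1,  v10) => [:: (- (a * Q / G), (v1, v0));
                      (q * (q ^+ 2 - Q * u) / G, (v10, v1));
                      (q * a / G, (v0, v10))]
  | (v10, v10) => [:: (Q^-1, (v10, v10))]
  | (k, l) => [:: (1, (l, k))]
  end.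

Definition U_tab (t : basisV * basisV) : comb F basisV :=
  match t with
  | (v1,  v1)  | (v0, v10) => [:: (1, v1)]
  | (v0,  v0)  | (v10, v1) => [:: (1, v0)]
  | (v1,  v0)  => [:: (1, v10)]
  | (v10, v10) => [:: (- (Q / q), v10)]
  | _ => [::]
  end.

Definition D_tab (k : basisV) : comb F (basisV * basisV) :=
  match k with
  | v1  => [:: (1, (v1, v1)); (1, (v10, v0))]
  | v0  => [:: (1, (v1, v10)); (1, (v0, v0))]
  | v10 => [:: (1, (v0, v1)); (- q, (v10, v10))]
  end.

Lemma tabulates_Rgr z :
  tabulates (@ketp F) (@ketp F) (Rgr_shifted q beta z) (Rgr_tab z).
Proof.
by case=> -[] [] /=; rewrite lin2_ket2 /eval /= ?big_cons big_nil /= ?aparE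
  ?scale1r ?scaleNr ?addr0.
Qed.

Lemma scale_sum3 (D x y w : F) n (A B C : 'cV[F]_n) :
  D^-1 *: (x *: A + y *: B + w *: C) =
  (x / D) *: A + ((y / D) *: B + ((w / D) *: C + 0)).
Proof. by rewrite !scalerDr !scalerA addr0 addrA ![D^-1 * _]mulrC. Qed.

Lemma tabulates_Rbr u :
  tabulates (@ketp F) (@ketp F) (Rbr_shifted q beta u^-1) (Rbr_tab u).
Proof.
case=> -[] [] /=; rewrite lin2_ket2 /eval /= ?big_cons big_nil /= ?aparE ?invrK;
  by rewrite -?scaleNr ?scale_sum3 ?addr0 ?scale1r.
Qed.

Lemma tabulates_Rgb u :
  tabulates (@ketp F) (@ketp F) (Rgb_shifted q beta u^-1) (Rgb_tab u).
Proof.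
case=> -[] [] /=; rewrite lin2_ket2 /eval /= ?big_cons big_nil /= ?aparE ?invrK;
  by rewrite -?scaleNr ?scale_sum3 ?addr0 ?scale1r.
Qed.

Lemma tabulates_Umx : tabulates (@ketp F) (@ket F) (Umx q beta) U_tab.
Proof.
by case=> -[] [] /=; rewrite lin2_ket2 /eval /= ?big_cons big_nil /= ?addr0
  ?scale1r.
Qed.

Lemma tabulates_Dmx : tabulates (@ket F) (@ketp F) (Dmx q) D_tab.
Proof.
by case=> /=; rewrite lin1_ket /eval /= ?big_cons big_nil /= ?addr0 ?scale1r
  ?scaleNr.
Qed.

(** * Intertwining relations over an arbitrary field *)

Definition is_generator (l : 'I_3) (x : gen) : Prop :=
  [\/ x = gE l, x = gF l, x = gK1 l | x = gK2 l].

Definition intertwines (R : 'M[F]_(3 * 3)) (rho sigma : Uq_rep q beta) : Prop :=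
  forall l X, is_generator l X ->
  R *m rep_tens rho sigma (Delta X) = rep_tens sigma rho (Delta X) *m R.

Lemma intertwines_inv R (rho sigma : Uq_rep q beta) : R \in unitmx ->
  intertwines R rho sigma -> intertwines (invmx R) sigma rho.
Proof.
move=> uR Rrs l X genX; apply: (can_inj (mulKmx uR)).
by rewrite mulKVmx // mulmxA (Rrs l) // mulmxK.
Qed.

Lemma intertwines_coef R r (rho sigma : Uq_rep q beta) c d zc zd :
  q != 0 -> Q != 0 -> tabulates (@ketp F) (@ketp F) R r ->
  rho =1 rho_gen q beta c zc -> sigma =1 rho_gen q beta d zd ->
  (forall l X, is_generator l X -> forall t s,
    coef eqVV (bind r (Delta_tab (rho_tab c zc) (rho_tab d zd) X t)) s =
    coef eqVV (bind (Delta_tab (rho_tab d zd) (rho_tab c zc) X) (r t)) s) ->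
  intertwines R rho sigma.
Proof.
move=> q0 Q0 Rr rhoE sigmaE coefE l X genX; apply: ketpP => t.
have rhoP x := tabulates_rep x q0 Q0 rhoE.
have sigmaP x := tabulates_rep x q0 Q0 sigmaE.
rewrite (tabulates_mul (tabulates_Delta X rhoP sigmaP) Rr).
rewrite (tabulates_mul Rr (tabulates_Delta X sigmaP rhoP)).
by apply: eval_eqVV => s; apply: coefE genX _ _.
Qed.

Lemma tabulated_unit R r r' : tabulates (@ketp F) (@ketp F) R r ->
  (forall t s, coef eqVV (bind r (r' t)) s = coef eqVV [:: (1, t)] s) ->
  R \in unitmx.
Proof.
move=> Rr rr'.
suff: R *m lin2 (fun k l => eval (@ketp F) (r' (k, l))) = 1%:M.
  by case/mulmx1_unit.
apply: ketpP => -[k l].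
rewrite -mulmxA [lin2 _ *m _]lin2_ket2 (eval_bind _ Rr) mul1mx -[RHS]eval1.
exact: eval_eqVV.
Qed.

(** A copy of [tri] that reduces through the projection of the ordinal record
    itself, so that evaluating it does not unfold the subtype structure. *)
Definition tri_ord (T : Type) (x0 x1 x2 : T) (i : 'I_3) : T :=
  match nat_of_ord i with 0%N => x0 | 1%N => x1 | _ => x2 end.

(* Only the constants listed are unfolded: the field operations have to stay
   folded for the field decision procedure to recognize them. *)
Ltac compute_coef :=
  cbv delta [Delta_tab word_tab rho_tab matrix_unit label posE Defs.coefE
    Defs.coefF diagK1 diagK2];
  change @tri with tri_ord;
  cbv [coef bind scale tensor map flatten foldr cat Delta tri_ord
    basisV_ord nat_of_ord o1 o2 o3 eqV eqVV fst snd andb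
    Rgr_tab Rbr_tab Rgb_tab Rgr_inv_tab Rbr_inv_tab Rgb_inv_tab U_tab D_tab].

Ltac check_coef :=
  compute_coef; try reflexivity;
  field; repeat (apply/andP; split); rewrite ?oner_eq0 //.

(** The relation between the two evaluation parameters and the argument of the
    R-matrix is built into the parameters, here and in the next two lemmas, so
    that [field] has plain identities to prove, without equational
    hypotheses. *)
Lemma Rgr_intertwines (x y : F) (rho sigma : Uq_rep q beta) :
  q != 0 -> Q != 0 -> Q - q ^+ 2 * x != 0 -> x != 0 -> y != 0 ->
  rho =1 rho_gen q beta green (q ^+ 2 * x * y) ->
  sigma =1 rho_gen q beta red y ->
  intertwines (Rgr_shifted q beta x) rho sigma.
Proof.
move=> q0 Q0 E0 x0 y0 rhoE sigmaE.
apply: (intertwines_coef q0 Q0 (tabulates_Rgr x) rhoE sigmaE) => l X.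
by case=> ->; move: l; apply: ord3P => -[[] []] [[] []]; check_coef.
Qed.

Lemma Rbr_intertwines (u y : F) (rho sigma : Uq_rep q beta) :
  q != 0 -> Q != 0 -> Q - q ^+ 2 * u != 0 -> u != 0 -> y != 0 ->
  rho =1 rho_gen q beta blue y ->
  sigma =1 rho_gen q beta red (q * u * y) ->
  intertwines (Rbr_shifted q beta u^-1) rho sigma.
Proof.
move=> q0 Q0 D0 u0 y0 rhoE sigmaE.
apply: (intertwines_coef q0 Q0 (tabulates_Rbr u) rhoE sigmaE) => l X.
by case=> ->; move: l; apply: ord3P => -[[] []] [[] []]; check_coef.
Qed.

Lemma Rgb_intertwines (u y : F) (rho sigma : Uq_rep q beta) :
  q != 0 -> Q != 0 -> Q - q ^+ 2 * u != 0 -> u != 0 -> y != 0 ->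
  rho =1 rho_gen q beta green (q ^+ 3 * y) ->
  sigma =1 rho_gen q beta blue (u * y) ->
  intertwines (Rgb_shifted q beta u^-1) rho sigma.
Proof.
move=> q0 Q0 D0 u0 y0 rhoE sigmaE.
apply: (intertwines_coef q0 Q0 (tabulates_Rgb u) rhoE sigmaE) => l X.
by case=> ->; move: l; apply: ord3P => -[[] []] [[] []]; check_coef.
Qed.

Lemma Rgr_unit x : q != 0 -> Q != 0 -> Q - q ^+ 2 * x != 0 -> 1 - x != 0 ->
  Q ^+ 2 - q ^+ 4 * x != 0 -> Rgr_shifted q beta x \in unitmx.
Proof.
move=> q0 Q0 E0 x1 N0.
apply: (tabulated_unit (tabulates_Rgr x) (r' := Rgr_inv_tab x)).
by case=> -[] [] [] [] []; check_coef.
Qed.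

Lemma Rbr_unit u : q != 0 -> Q != 0 -> Q - q ^+ 2 * u != 0 ->
  q ^+ 4 - Q ^+ 2 * u != 0 -> Rbr_shifted q beta u^-1 \in unitmx.
Proof.
move=> q0 Q0 D0 G0.
apply: (tabulated_unit (tabulates_Rbr u) (r' := Rbr_inv_tab u)).
by case=> -[] [] [] [] []; check_coef.
Qed.

Lemma Rgb_unit u : q != 0 -> Q != 0 -> Q - q ^+ 2 * u != 0 ->
  q ^+ 4 - Q ^+ 2 * u != 0 -> Rgb_shifted q beta u^-1 \in unitmx.
Proof.
move=> q0 Q0 D0 G0.
apply: (tabulated_unit (tabulates_Rgb u) (r' := Rgb_inv_tab u)).
by case=> -[] [] [] [] []; check_coef.
Qed.

Lemma U_intertwines (z : F) (rho sigma tau : Uq_rep q beta) :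
  q != 0 -> Q != 0 -> z != 0 ->
  rho =1 rho_gen q beta green (q * z) ->
  sigma =1 rho_gen q beta red (q^-1 * z) ->
  tau =1 rho_gen q beta blue (q ^- 2 * z) ->
  forall l X, is_generator l X ->
  Umx q beta *m rep_tens rho sigma (Delta X) = tau X *m Umx q beta.
Proof.
move=> q0 Q0 z0 rhoE sigmaE tauE l X genX; apply: ketpP => t.
have rhoP x := tabulates_rep x q0 Q0 rhoE.
have sigmaP x := tabulates_rep x q0 Q0 sigmaE.
rewrite (tabulates_mul (tabulates_Delta X rhoP sigmaP) tabulates_Umx).
rewrite (tabulates_mul tabulates_Umx (tabulates_rep X q0 Q0 tauE)).
apply: eval_eqV => s {rhoP sigmaP}.
by case: genX t s => ->; move: l; apply: ord3P => -[[] []] []; check_coef.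
Qed.

Lemma D_intertwines (z : F) (rho sigma tau : Uq_rep q beta) :
  q != 0 -> Q != 0 -> z != 0 ->
  rho =1 rho_gen q beta red (q^-1 * z) ->
  sigma =1 rho_gen q beta green (q * z) ->
  tau =1 rho_gen q beta blue (q ^- 2 * z) ->
  forall l X, is_generator l X ->
  Dmx q *m tau X = rep_tens rho sigma (Delta X) *m Dmx q.
Proof.
move=> q0 Q0 z0 rhoE sigmaE tauE l X genX; apply: ketP => t.
have rhoP x := tabulates_rep x q0 Q0 rhoE.
have sigmaP x := tabulates_rep x q0 Q0 sigmaE.
rewrite (tabulates_mul (tabulates_rep X q0 Q0 tauE) tabulates_Dmx).
rewrite (tabulates_mul tabulates_Dmx (tabulates_Delta X rhoP sigmaP)).
apply: eval_eqVV => s {rhoP sigmaP}.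
by case: genX t s => ->; move: l; apply: ord3P => -[] [[] []]; check_coef.
Qed.

(** * The normalized R-matrices at a ratio of parameters *)

(** The conditions under which the three R-matrices at [y / x] are defined and
    invertible, cleared of denominators. *)
Record generic (x y : F) : Prop := Generic {
  generic_x : x != 0;
  generic_y : y != 0;
  generic_gr : Q * y - x != 0;
  generic_gr1 : q ^+ 2 * y - x != 0;
  generic_gr2 : Q ^+ 2 * y - q ^+ 2 * x != 0;
  generic_br : Q * x - q * y != 0;
  generic_br1 : q ^+ 5 * x - Q ^+ 2 * y != 0;
  generic_gb : Q * x - q ^+ 5 * y != 0;
  generic_gb1 : q * x - Q ^+ 2 * y != 0
}.

Lemma neq0_by_factor (c e f : F) : c != 0 -> e != 0 -> f = c * e -> f != 0.
Proof. by move=> c0 e0 ->; apply: mulf_neq0. Qed.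

Section Ratio.
Variables (x y : F) (rho sigma : Uq_rep q beta).
Hypotheses (q0 : q != 0) (Q0 : Q != 0) (xy : generic x y).

Lemma Rbar_gr_intertwines :
  rho =1 rho_gen q beta green x -> sigma =1 rho_gen q beta red y ->
  Rbar q beta green red (y / x) \in unitmx /\
  intertwines (Rbar q beta green red (y / x)) rho sigma.
Proof.
case: xy => x0 y0 gr gr1 gr2 _ _ _ _ rhoE sigmaE.
have c0 : q ^- 2 / y != 0 by rewrite mulf_neq0 ?invr_eq0 ?expf_neq0.
have -> : Rbar q beta green red (y / x) =
    Rgr_shifted q beta (x / (q ^+ 2 * y)).
  by rewrite /= /Rgr; congr Rgr_shifted; field; rewrite y0 q0 x0.
have E0 : Q - q ^+ 2 * (x / (q ^+ 2 * y)) != 0.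
  by apply: (neq0_by_factor (invr_neq0 y0) gr); field; rewrite q0 y0.
split.
- apply: Rgr_unit => //.
    by apply: (neq0_by_factor c0 gr1); field; rewrite q0 y0.
  by apply: (neq0_by_factor (invr_neq0 y0) gr2); field; rewrite q0 y0.
- apply: (@Rgr_intertwines _ y) => //.
    by rewrite mulf_neq0 ?invr_eq0 ?mulf_neq0 ?expf_neq0.
  suff -> : q ^+ 2 * (x / (q ^+ 2 * y)) * y = x by [].
  by field; rewrite q0 y0.
Qed.

Lemma Rbar_br_intertwines :
  rho =1 rho_gen q beta blue x -> sigma =1 rho_gen q beta red y ->
  Rbar q beta blue red (y / x) \in unitmx /\
  intertwines (Rbar q beta blue red (y / x)) rho sigma.
Proof.
case: xy => x0 y0 _ _ _ br br1 _ _ rhoE sigmaE.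
have -> : Rbar q beta blue red (y / x) = Rbr_shifted q beta (y / (q * x))^-1.
  by rewrite /= /Rbr; congr Rbr_shifted; field; rewrite y0 q0 x0.
have D0 : Q - q ^+ 2 * (y / (q * x)) != 0.
  by apply: (neq0_by_factor (invr_neq0 x0) br); field; rewrite q0 x0.
split.
- apply: Rbr_unit => //.
  apply: (neq0_by_factor (invr_neq0 (mulf_neq0 q0 x0)) br1).
  by field; rewrite q0 x0.
- apply: (@Rbr_intertwines _ x) => //.
    by rewrite mulf_neq0 ?invr_eq0 ?mulf_neq0.
  suff -> : q * (y / (q * x)) * x = y by [].
  by field; rewrite q0 x0.
Qed.

Lemma Rbar_gb_intertwines :
  rho =1 rho_gen q beta green x -> sigma =1 rho_gen q beta blue y ->
  Rbar q beta green blue (y / x) \in unitmx /\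
  intertwines (Rbar q beta green blue (y / x)) rho sigma.
Proof.
case: xy => x0 y0 _ _ _ _ _ gb gb1 rhoE sigmaE.
have -> : Rbar q beta green blue (y / x) =
    Rgb_shifted q beta (q ^+ 3 * y / x)^-1.
  by rewrite /= /Rgb; congr Rgb_shifted; field; rewrite y0 q0 x0.
have D0 : Q - q ^+ 2 * (q ^+ 3 * y / x) != 0.
  by apply: (neq0_by_factor (invr_neq0 x0) gb); field; rewrite x0.
split.
- apply: Rgb_unit => //.
  have c0 : q ^+ 3 / x != 0 by rewrite mulf_neq0 ?invr_eq0 ?expf_neq0.
  by apply: (neq0_by_factor c0 gb1); field; rewrite x0.
- apply: (@Rgb_intertwines _ (q ^- 3 * x)) => //.
  + by rewrite !mulf_neq0 ?invr_eq0 ?expf_neq0.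
  + by rewrite mulf_neq0 ?invr_eq0 ?expf_neq0.
  + suff -> : q ^+ 3 * (q ^- 3 * x) = x by [].
    by field; rewrite q0.
  + suff -> : q ^+ 3 * y / x * (q ^- 3 * x) = y by [].
    by field; rewrite q0 x0.
Qed.

End Ratio.

Lemma Rbar_rg w : Rbar q beta red green w = invmx (Rbar q beta green red w^-1).
Proof. by []. Qed.

Lemma Rbar_rb w : Rbar q beta red blue w = invmx (Rbar q beta blue red w^-1).
Proof. by []. Qed.

Lemma Rbar_bg w : Rbar q beta blue green w = invmx (Rbar q beta green blue w^-1).
Proof. by []. Qed.

End Operators.

(** * Genericity of the indeterminates *)

(** Sending the [k]-th indeterminate to [k] specializes [q] to 0 and [beta]
    to 1, hence [Q] to 1; each condition then reduces to the nonvanishing of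
    [i], of [j] or of [j - i]. *)
Lemma indet_generic (i j : nat) (i_lt5 : (i < 5)%N) (j_lt5 : (j < 5)%N) :
  (0 < i)%N -> (0 < j)%N -> i != j ->
  generic q beta (indet i_lt5) (indet j_lt5).
Proof.
move=> i_gt0 j_gt0 neq_ij.
split; rewrite ?indet_neq0 // /q ?[Qpar _ _]Qpar_tofrac -?tofracXn -?tofracM;
  rewrite -?tofracB; apply: (@tofrac_neq0 _ (fun k => k%:R));
  rewrite !(mevalB, mevalM, mevalD, rmorphXn, mvarE) /=;
  rewrite !(mul0r, mulr0, mul1r, mulr1, subr0, sub0r, add0r, oppr_eq0).
- by rewrite subr_eq0 Num.Theory.eqr_nat eq_sym.
all: by rewrite Num.Theory.pnatr_eq0 -lt0n.
Qed.

Lemma z1_z2_generic : generic q beta z1 z2.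
Proof. exact: indet_generic. Qed.

Lemma z2_z1_generic : generic q beta z2 z1.
Proof. exact: indet_generic. Qed.

Theorem theorem1p8 (l : 'I_3) (X : gen)
    (hX : [\/ X = gE l, X = gF l, X = gK1 l | X = gK2 l]) :
  [/\ forall i j : color, i <> j ->
        Rbar q beta i j (z2 / z1)
          *m rep_tens (rho i z1 z1_neq0) (rho j z2 z2_neq0) (Delta X) =
        rep_tens (rho j z2 z2_neq0) (rho i z1 z1_neq0) (Delta X)
          *m Rbar q beta i j (z2 / z1),
      Umx q beta
          *m rep_tens (rho green (q * z) qz_neq0) (rho red (q^-1 * z) qVz_neq0)
               (Delta X) =
        rho blue (q ^- 2 * z) qV2z_neq0 X *m Umx q beta
    & Dmx q *m rho blue (q ^- 2 * z) qV2z_neq0 X =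
        rep_tens (rho red (q^-1 * z) qVz_neq0) (rho green (q * z) qz_neq0)
             (Delta X)
          *m Dmx q].
Proof.
have q0 := q_neq0; have Q0 := Qpar_neq0.
split; last 2 first.
- by apply: U_intertwines q0 Q0 z_neq0 _ _ _ _ _ hX.
- by apply: D_intertwines q0 Q0 z_neq0 _ _ _ _ _ hX.
suff Rij i j : i <> j ->
    intertwines (Rbar q beta i j (z2 / z1)) (rho i z1 z1_neq0) (rho j z2 z2_neq0).
  by move=> i j ij; apply: Rij ij _ _ hX.
have z12 := z1_z2_generic; have z21 := z2_z1_generic.
case: i; case: j => // _.
- by have [] := @Rbar_gr_intertwines _ _ _ _ _ (rho green z1 z1_neq0)
    (rho red z2 z2_neq0) q0 Q0 z12.
- by have [] := @Rbar_gb_intertwines _ _ _ _ _ (rho green z1 z1_neq0)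
    (rho blue z2 z2_neq0) q0 Q0 z12.
- rewrite Rbar_rg invf_div; have [] // := @Rbar_gr_intertwines _ _ _ _ _
    (rho green z2 z2_neq0) (rho red z1 z1_neq0) q0 Q0 z21.
  exact: intertwines_inv.
- rewrite Rbar_rb invf_div; have [] // := @Rbar_br_intertwines _ _ _ _ _
    (rho blue z2 z2_neq0) (rho red z1 z1_neq0) q0 Q0 z21.
  exact: intertwines_inv.
- rewrite Rbar_bg invf_div; have [] // := @Rbar_gb_intertwines _ _ _ _ _
    (rho green z2 z2_neq0) (rho blue z1 z1_neq0) q0 Q0 z21.
  exact: intertwines_inv.
- by have [] := @Rbar_br_intertwines _ _ _ _ _ (rho blue z1 z1_neq0)
    (rho red z2 z2_neq0) q0 Q0 z12.
Qed.
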